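(* Let $\Omega=[a,b]$ and consider a sufficiently smooth solution of the explicit (descriptor) Euler--Bernoulli system $$\begin{bmatrix} \partial_t\varepsilon_w \\ \partial_tp_w \\ \partial_t\varepsilon_\phi \\ 0 \\ 0 \end{bmatrix}=\begin{bmatrix} 0&\partial_x&0&0&0 \\ \partial_x&0&0&0&\partial_x \\ 0&0&0&\partial_x&0 \\ 0&0&\partial_x&0&\mathrm{Id} \\ 0&\partial_x&0&-\mathrm{Id}&0 \end{bmatrix}\begin{bmatrix} \sigma_w \\ v \\ \sigma_\phi \\ \omega \\ N \end{bmatrix}$$ with $v=\frac{p_w}{\rho A}$, $\sigma_w=T_0\varepsilon_w$, $\sigma_\phi=EI\,\varepsilon_\phi$, and the constrained Hamiltonian $$\mathcal{H}_c^E=\frac12\int_\Omega\frac{p_w^2}{\rho A}+T_0\varepsilon_w^2+EI\,\varepsilon_\phi^2\,dx.$$ Then the power balance reads $$\frac{d}{dt}\mathcal{H}_c^E=\big[v\,\sigma_w-v\,\partial_x\sigma_\phi+\sigma_\phi\,\partial_xv\big]_a^b.$$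
   Context: $\rho,A,T_0,I,E$ are positive time-independent physical parameters (mass density, cross-section area, tension, moment of inertia, Young's modulus). This system is the Timoshenko beam model constrained by setting to zero the time derivatives of the angular momentum and of $\varepsilon_{w,\phi}$ (the difference between the deformation $\partial_xw$ and the shear angle). The efforts $\omega$ and $N$ are determined by the last two (algebraic) rows. $[g]_a^b:=g(b)-g(a)$. *)

(* Defs.v *)
From Stdlib Require Import Reals.
From Coquelicot Require Import Coquelicot.
Open Scope R_scope.

(** Stdlib reals with Coquelicot.  Fields on space-time are functions
    [f : R -> R -> R], applied as [f t x] (time first, space second). *)

Definition d_t (f : R -> R -> R) (t x : R) : R := Derive (fun s => f s x) t.
Definition d_x (f : R -> R -> R) (t x : R) : R := Derive (fun y => f t y) x.

(** Smoothness is required on a full neighbourhood of each point considered: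
    a function that is C^1 up to the boundary of [a,b] is represented by a C^1
    extension across the end points, so that the two-sided [Derive] there is
    the one-sided derivative of the restriction to [a,b]. *)
Definition C1_near (g : R -> R) (x : R) : Prop :=
  locally x (fun y => ex_derive g y /\ continuous (Derive g) y).

Definition C1_near_2d (f : R -> R -> R) (t x : R) : Prop :=
  locally_2d (fun s y =>
    ex_derive (fun r => f r y) s /\ ex_derive (fun z => f s z) y /\
    continuity_2d_pt (d_t f) s y /\ continuity_2d_pt (d_x f) s y) t x.

(** The physical parameters do not depend on time but may vary along the
    beam; constant parameters are the case of constant functions. *)
Record beam : Type := Beam {
  rho : R -> R;
  area : R -> R;
  tension : R -> R;
  inertia : R -> R;
  young : R -> R
}.

Record admissible_beam (B : beam) (a b : R) : Prop := {
  rho_pos : forall x, a <= x <= b -> 0 < rho B x;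
  area_pos : forall x, a <= x <= b -> 0 < area B x;
  tension_pos : forall x, a <= x <= b -> 0 < tension B x;
  inertia_pos : forall x, a <= x <= b -> 0 < inertia B x;
  young_pos : forall x, a <= x <= b -> 0 < young B x;
  rho_C1 : forall x, a <= x <= b -> C1_near (rho B) x;
  area_C1 : forall x, a <= x <= b -> C1_near (area B) x;
  tension_C1 : forall x, a <= x <= b -> C1_near (tension B) x;
  inertia_C1 : forall x, a <= x <= b -> C1_near (inertia B) x;
  young_C1 : forall x, a <= x <= b -> C1_near (young B) x
}.

Record fields : Type := Fields {
  eps_w : R -> R -> R;
  p_w : R -> R -> R;
  eps_phi : R -> R -> R;
  omega : R -> R -> R;
  effort_N : R -> R -> R
}.

Definition vel (B : beam) (u : fields) (t x : R) : R :=
  p_w u t x / (rho B x * area B x).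
Definition sigma_w (B : beam) (u : fields) (t x : R) : R :=
  tension B x * eps_w u t x.
Definition sigma_phi (B : beam) (u : fields) (t x : R) : R :=
  young B x * inertia B x * eps_phi u t x.

(** C^1 regularity of all five fields is enough for every term of the system
    to be classical; the last two rows then make [vel] and [sigma_phi] twice
    continuously differentiable in space. *)
Record C1_fields (u : fields) (t x : R) : Prop := {
  eps_w_C1 : C1_near_2d (eps_w u) t x;
  p_w_C1 : C1_near_2d (p_w u) t x;
  eps_phi_C1 : C1_near_2d (eps_phi u) t x;
  omega_C1 : C1_near_2d (omega u) t x;
  N_C1 : C1_near_2d (effort_N u) t x
}.

(** The rows, at the point [(t, x)], of
<<
    [ d_t eps_w   ]   [ 0    d_x  0    0    0   ] [ sigma_w   ]
    [ d_t p_w     ]   [ d_x  0    0    0    d_x ] [ vel       ]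
    [ d_t eps_phi ] = [ 0    0    0    d_x  0   ] [ sigma_phi ]
    [ 0           ]   [ 0    0    d_x  0    Id  ] [ omega     ]
    [ 0           ]   [ 0    d_x  0    -Id  0   ] [ effort_N  ]
>> *)
Record euler_bernoulli (B : beam) (u : fields) (t x : R) : Prop := {
  EB_eps_w : d_t (eps_w u) t x = d_x (vel B u) t x;
  EB_p_w : d_t (p_w u) t x = d_x (sigma_w B u) t x + d_x (effort_N u) t x;
  EB_eps_phi : d_t (eps_phi u) t x = d_x (omega u) t x;
  EB_N : 0 = d_x (sigma_phi B u) t x + effort_N u t x;
  EB_omega : 0 = d_x (vel B u) t x - omega u t x
}.

Definition hamiltonian (B : beam) (a b : R) (u : fields) (t : R) : R :=
  / 2 * RInt (fun x =>
      (p_w u t x) ^ 2 / (rho B x * area B x)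
      + tension B x * (eps_w u t x) ^ 2
      + young B x * inertia B x * (eps_phi u t x) ^ 2) a b.

Definition bracket (g : R -> R) (a b : R) : R := g b - g a.

(* Main.v *)
(** The power flux through a cross-section is [G = v sigma_w + v N + sigma_phi omega].
    The three evolution rows turn the time derivative of the energy density
    into [d_x G - (d_x v * N + d_x sigma_phi * omega)], and the algebraic rows
    [N = - d_x sigma_phi], [omega = d_x v] make the parenthesis vanish.
    Integrating over [[a, b]] leaves the boundary values of [G], in which the
    algebraic rows are used once more. *)

Require Import Defs.
From Stdlib Require Import Reals Lra.
From Coquelicot Require Import Coquelicot.
Open Scope R_scope.

(** * Calculus of functions that are C^1 near a point *)

Lemma C1_near_ex_derive (f : R -> R) (x : R) : C1_near f x -> ex_derive f x.
Proof. intros H; exact (proj1 (locally_singleton _ _ H)). Qed.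

Lemma C1_near_continuous (f : R -> R) (x : R) : C1_near f x -> continuous f x.
Proof.
  intros H; apply (@ex_derive_continuous R_AbsRing R_NormedModule).
  now apply C1_near_ex_derive.
Qed.

Lemma C1_near_continuous_Derive (f : R -> R) (x : R) :
  C1_near f x -> continuous (Derive f) x.
Proof. intros H; exact (proj2 (locally_singleton _ _ H)). Qed.

Lemma C1_near_locally (f : R -> R) (x : R) :
  C1_near f x -> locally x (C1_near f).
Proof. apply locally_locally. Qed.

(** At each [y] near [x] the formula [df] agrees with [Derive f] on a whole neighbourhood of [y], so
    continuity passes from [df] to [Derive f]. The closure lemmas below then only have to exhibit an
    explicit derivative. *)
Lemma C1_near_intro (f df : R -> R) (x : R) :
  locally x (fun y => is_derive f y (df y) /\ continuous df y) -> C1_near f x.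
Proof.
  intros H0. apply locally_locally in H0. revert H0.
  unfold C1_near; apply filter_imp; intros y H. split.
  - exists (df y). exact (proj1 (locally_singleton _ _ H)).
  - apply continuous_ext_loc with df.
    + revert H; apply filter_imp; intros z [Hz _].
      symmetry; now apply is_derive_unique.
    + exact (proj2 (locally_singleton _ _ H)).
Qed.

Lemma C1_near_plus (f g : R -> R) (x : R) :
  C1_near f x -> C1_near g x -> C1_near (fun y => f y + g y) x.
Proof.
  intros Hf Hg.
  apply C1_near_intro with (fun y => Derive f y + Derive g y).
  generalize (filter_and _ _ Hf Hg); apply filter_imp.
  intros y [[Ef Cf] [Eg Cg]]; split.
  - apply @is_derive_plus; now apply Derive_correct.
  - now apply (@continuous_plus _ _ R_NormedModule (Derive f) (Derive g)).
Qed.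

Lemma C1_near_mult (f g : R -> R) (x : R) :
  C1_near f x -> C1_near g x -> C1_near (fun y => f y * g y) x.
Proof.
  intros Hf Hg.
  apply C1_near_intro with (fun y => Derive f y * g y + f y * Derive g y).
  generalize (filter_and _ _ (C1_near_locally _ _ Hf) (C1_near_locally _ _ Hg)).
  apply filter_imp; intros y [Cf Cg]; split.
  - apply Derive.is_derive_mult; apply Derive_correct; now apply C1_near_ex_derive.
  - apply (@continuous_plus _ _ R_NormedModule
             (fun z => Derive f z * g z) (fun z => f z * Derive g z));
      apply @continuous_mult;
      first [ now apply C1_near_continuous | now apply C1_near_continuous_Derive ].
Qed.

(** By continuity [f] stays nonzero on a neighbourhood of [x], where the quotient rule applies. *)
Lemma C1_near_inv (f : R -> R) (x : R) :
  C1_near f x -> f x <> 0 -> C1_near (fun y => / f y) x.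
Proof.
  intros Hf Nf.
  assert (L : locally x (fun y => f y <> 0)).
  { apply (C1_near_continuous _ _ Hf (fun r => r <> 0)).
    now apply open_neq. }
  apply C1_near_intro with (fun y => - Derive f y * (/ f y * / f y)).
  generalize (filter_and _ _ (C1_near_locally _ _ Hf) L).
  apply filter_imp; intros y [Cf Ny]; split.
  - replace (- Derive f y * (/ f y * / f y)) with (- Derive f y / f y ^ 2)
      by (field; exact Ny).
    apply is_derive_inv; [ apply Derive_correct; now apply C1_near_ex_derive | exact Ny ].
  - apply @continuous_mult.
    + apply (@continuous_opp _ _ R_NormedModule (Derive f)).
      now apply C1_near_continuous_Derive.
    + apply @continuous_mult;
        apply continuous_Rinv_comp; trivial; now apply C1_near_continuous.
Qed.

(** * From joint regularity in time and space to regularity at fixed time *)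

Lemma continuous_slice (f : R -> R -> R) (t x : R) :
  continuity_2d_pt f t x -> continuous (f t) x.
Proof.
  intros H P [eps HP].
  destruct (H eps) as [d Hd].
  exists d; intros y Hy. apply HP. apply (Hd t y); trivial.
  rewrite Rminus_diag, Rabs_R0. apply cond_pos.
Qed.

Lemma continuity_2d_pt_of_continuous (k : R -> R) (t x : R) :
  continuous k x -> continuity_2d_pt (fun _ y => k y) t x.
Proof.
  intros H. apply (continuity_1d_2d_pt_comp k (fun _ y => y)).
  - now apply continuity_pt_filterlim.
  - apply continuity_2d_pt_id2.
Qed.

Lemma C1_near_2d_ex_derive_t (f : R -> R -> R) (t x : R) :
  C1_near_2d f t x -> ex_derive (fun s => f s x) t.
Proof. intros H; exact (proj1 (locally_2d_singleton _ _ _ H)). Qed.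

(** Joint continuity follows from total differentiability: the time derivative exists around
    [(t, x)] and is continuous there, and the space derivative exists at the point. *)
Lemma C1_near_2d_continuity (f : R -> R -> R) (t x : R) :
  C1_near_2d f t x -> continuity_2d_pt f t x.
Proof.
  intros H.
  apply continuity_2d_pt_filterlim.
  apply (filterdiff_continuous (fun u : R * R => f (fst u) (snd u))).
  destruct (locally_2d_singleton _ _ _ H) as [_ [Ey [Ct _]]].
  eexists.
  apply (is_derive_filterdiff f t x (d_t f) (d_x f t x)).
  - apply locally_2d_locally in H. revert H; apply filter_imp.
    intros [s y] [Es _]. now apply Derive_correct.
  - now apply Derive_correct.
  - now apply continuity_2d_pt_filterlim.
Qed.

Lemma C1_near_2d_slice (f : R -> R -> R) (t x : R) :
  C1_near_2d f t x -> C1_near (f t) x.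
Proof.
  intros [d H]. exists d; intros y Hy.
  destruct (H t y) as [_ [Ey [_ Cx]]]; trivial.
  { rewrite Rminus_diag, Rabs_R0. apply cond_pos. }
  split; trivial. now apply (continuous_slice (d_x f)).
Qed.

(** * Time derivative of a quadratic energy term with weight [k] *)

Lemma is_derive_weighted_square (k : R -> R) (f : R -> R -> R) (t x : R) :
  ex_derive (fun s => f s x) t ->
  is_derive (fun s => k x * f s x ^ 2) t (2 * (k x * f t x * d_t f t x)).
Proof.
  intros Et. unfold d_t. auto_derive; trivial. ring.
Qed.

Section WeightedSquareIntegral.

Variables (a b : R) (k : R -> R) (f : R -> R -> R) (t : R).
Hypothesis hab : a <= b.
Hypothesis hk : forall x, a <= x <= b -> continuous k x.
Hypothesis hf :
  locally t (fun s => forall x, a <= x <= b -> C1_near_2d f s x).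

Lemma continuous_weighted_square (s x : R) :
  a <= x <= b -> C1_near_2d f s x -> continuous (fun y => k y * f s y ^ 2) x.
Proof.
  intros Hx H. simpl.
  assert (C := C1_near_continuous _ _ (C1_near_2d_slice _ _ _ H)).
  repeat apply @continuous_mult; auto. apply continuous_const.
Qed.

Lemma ex_RInt_weighted_square :
  locally t (fun s => ex_RInt (fun x => k x * f s x ^ 2) a b).
Proof.
  revert hf; apply filter_imp; intros s Hs.
  apply (@ex_RInt_continuous R_CompleteNormedModule).
  rewrite Rmin_left, Rmax_right by assumption.
  intros x Hx. apply continuous_weighted_square; auto.
Qed.

Lemma continuity_2d_weighted_square_rate (x : R) :
  a <= x <= b ->
  continuity_2d_pt (fun s y => 2 * (k y * f s y * d_t f s y)) t x.
Proof.
  intros Hx.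
  assert (H := locally_singleton _ _ hf x Hx).
  apply continuity_2d_pt_mult; [ apply continuity_2d_pt_const | ].
  apply continuity_2d_pt_mult.
  - apply continuity_2d_pt_mult.
    + apply continuity_2d_pt_of_continuous; auto.
    + now apply C1_near_2d_continuity.
  - now destruct (locally_2d_singleton _ _ _ H) as [_ [_ [Ct _]]].
Qed.

Lemma ex_RInt_weighted_square_rate :
  ex_RInt (fun x => 2 * (k x * f t x * d_t f t x)) a b.
Proof.
  apply (@ex_RInt_continuous R_CompleteNormedModule).
  rewrite Rmin_left, Rmax_right by assumption. intros x Hx.
  apply (continuous_slice (fun s y => 2 * (k y * f s y * d_t f s y))).
  now apply continuity_2d_weighted_square_rate.
Qed.

(** Differentiation under the integral sign is justified by the joint continuity of the rate at
    every [(t, x)] with [x] in [[a, b]]. *)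
Lemma is_derive_RInt_weighted_square :
  is_derive (fun s => RInt (fun x => k x * f s x ^ 2) a b) t
    (RInt (fun x => 2 * (k x * f t x * d_t f t x)) a b).
Proof.
  rewrite <- (RInt_ext (fun x => Derive (fun s => k x * f s x ^ 2) t)).
  2:{ rewrite Rmin_left, Rmax_right by assumption; intros x Hx.
      apply is_derive_unique, is_derive_weighted_square.
      apply C1_near_2d_ex_derive_t, (locally_singleton _ _ hf); lra. }
  apply (is_derive_RInt_param (fun s x => k x * f s x ^ 2));
    rewrite ?Rmin_left, ?Rmax_right by assumption.
  - revert hf; apply filter_imp; intros s Hs x Hx.
    eexists. now apply is_derive_weighted_square, C1_near_2d_ex_derive_t, Hs.
  - intros x Hx.
    (* The closed form of the rate must agree with [Derive] on a full neighbourhood of [(t, x)],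
       which leaves [[a, b]] when [x] is an end point; [C1_near_2d] supplies the derivative there
       too. *)
    apply continuity_2d_pt_ext_loc
      with (fun s y => 2 * (k y * f s y * d_t f s y)).
    + assert (H := locally_singleton _ _ hf x Hx).
      apply locally_2d_locally in H. apply locally_2d_locally.
      revert H. apply filter_imp. intros [s y] [Es _].
      symmetry; now apply is_derive_unique, is_derive_weighted_square.
    + now apply continuity_2d_weighted_square_rate.
  - apply ex_RInt_weighted_square.
Qed.

End WeightedSquareIntegral.

(** * The power flux and the pointwise power balance *)

(** The flux is written with [effort_N] and [omega], which are C^1 by assumption, rather than with
    the derivatives of [sigma_phi] and [vel]. No second space derivative then occurs, even at the
    end points, beyond which the algebraic rows are not assumed. *)
Definition power_flux (B : beam) (u : fields) (t x : R) : R :=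
  vel B u t x * sigma_w B u t x + vel B u t x * effort_N u t x
  + sigma_phi B u t x * omega u t x.

Section Beam.

Variables (a b : R) (B : beam) (u : fields).
Hypothesis hB : admissible_beam B a b.

Lemma C1_near_compliance (x : R) :
  a <= x <= b -> C1_near (fun y => / (rho B y * area B y)) x.
Proof.
  intros Hx. destruct hB. apply C1_near_inv.
  - now apply C1_near_mult; auto.
  - apply Rgt_not_eq, Rmult_lt_0_compat; auto.
Qed.

Lemma C1_near_stiffness (x : R) :
  a <= x <= b -> C1_near (fun y => young B y * inertia B y) x.
Proof. intros Hx. destruct hB. apply C1_near_mult; auto. Qed.

Section Point.

Variables (t x : R).
Hypothesis hx : a <= x <= b.
Hypothesis hu : C1_fields u t x.

Lemma C1_near_vel : C1_near (vel B u t) x.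
Proof.
  apply (C1_near_mult (p_w u t) (fun y => / (rho B y * area B y))).
  - apply C1_near_2d_slice, p_w_C1, hu.
  - now apply C1_near_compliance.
Qed.

Lemma C1_near_sigma_w : C1_near (sigma_w B u t) x.
Proof.
  apply (C1_near_mult (tension B) (eps_w u t)).
  - now apply (tension_C1 _ _ _ hB).
  - apply C1_near_2d_slice, eps_w_C1, hu.
Qed.

Lemma C1_near_sigma_phi : C1_near (sigma_phi B u t) x.
Proof.
  apply (C1_near_mult (fun y => young B y * inertia B y) (eps_phi u t)).
  - now apply C1_near_stiffness.
  - apply C1_near_2d_slice, eps_phi_C1, hu.
Qed.

Lemma C1_near_power_flux : C1_near (power_flux B u t) x.
Proof.
  assert (HN := C1_near_2d_slice _ _ _ (N_C1 _ _ _ hu)).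
  assert (Ho := C1_near_2d_slice _ _ _ (omega_C1 _ _ _ hu)).
  assert (Hv := C1_near_vel). assert (Hw := C1_near_sigma_w).
  assert (Hp := C1_near_sigma_phi).
  apply (C1_near_plus (fun y => vel B u t y * sigma_w B u t y
                                + vel B u t y * effort_N u t y)
                      (fun y => sigma_phi B u t y * omega u t y)).
  - apply (C1_near_plus (fun y => vel B u t y * sigma_w B u t y)
                        (fun y => vel B u t y * effort_N u t y));
      now apply C1_near_mult.
  - now apply C1_near_mult.
Qed.

Hypothesis hE : euler_bernoulli B u t x.

(** The right-hand side is the time derivative of the energy density, the factor 1/2 having
    cancelled the 2 from the squares. Of the six terms of the product rule, four match it through
    the evolution rows and the other two cancel. *)
Lemma Derive_power_flux :
  Derive (power_flux B u t) x =
    / (rho B x * area B x) * p_w u t x * d_t (p_w u) t x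
    + tension B x * eps_w u t x * d_t (eps_w u) t x
    + young B x * inertia B x * eps_phi u t x * d_t (eps_phi u) t x.
Proof.
  assert (HN := C1_near_ex_derive _ _ (C1_near_2d_slice _ _ _ (N_C1 _ _ _ hu))).
  assert (Ho := C1_near_ex_derive _ _ (C1_near_2d_slice _ _ _ (omega_C1 _ _ _ hu))).
  assert (Hv := C1_near_ex_derive _ _ C1_near_vel).
  assert (Hw := C1_near_ex_derive _ _ C1_near_sigma_w).
  assert (Hp := C1_near_ex_derive _ _ C1_near_sigma_phi).
  destruct hE as [E1 E2 E3 E4 E5].
  assert (DG : is_derive (power_flux B u t) x
    (d_x (vel B u) t x * sigma_w B u t x + vel B u t x * d_x (sigma_w B u) t x
     + (d_x (vel B u) t x * effort_N u t x + vel B u t x * d_x (effort_N u) t x)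
     + (d_x (sigma_phi B u) t x * omega u t x
        + sigma_phi B u t x * d_x (omega u) t x))).
  { apply (@is_derive_plus R_AbsRing R_NormedModule
      (fun y => vel B u t y * sigma_w B u t y + vel B u t y * effort_N u t y)
      (fun y => sigma_phi B u t y * omega u t y)).
    - apply (@is_derive_plus R_AbsRing R_NormedModule
        (fun y => vel B u t y * sigma_w B u t y)
        (fun y => vel B u t y * effort_N u t y));
        apply Derive.is_derive_mult; now apply Derive_correct.
    - apply Derive.is_derive_mult; now apply Derive_correct. }
  rewrite (is_derive_unique _ _ _ DG), E1, E2, E3.
  replace (d_x (sigma_phi B u) t x) with (- effort_N u t x) by lra.
  replace (omega u t x) with (d_x (vel B u) t x) by lra.
  (* Only the occurrences that stand as factors are unfolded; those under [d_x] remain atoms for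
     [ring]. *)
  unfold vel at 2 4, sigma_w at 1, sigma_phi at 1, Rdiv. ring.
Qed.

End Point.

End Beam.

Theorem theorem10 (a b : R) (hab : a < b) (t0 t1 : Rbar)
  (B : beam) (u : fields)
  (hB : admissible_beam B a b)
  (hC1 : forall t x : R, Rbar_lt t0 t -> Rbar_lt t t1 -> a <= x <= b ->
     C1_fields u t x)
  (hEB : forall t x : R, Rbar_lt t0 t -> Rbar_lt t t1 -> a <= x <= b ->
     euler_bernoulli B u t x) :
  forall t : R, Rbar_lt t0 t -> Rbar_lt t t1 ->
    is_derive (hamiltonian B a b u) t
      (bracket (fun x =>
         vel B u t x * sigma_w B u t x
         - vel B u t x * d_x (sigma_phi B u) t x
         + sigma_phi B u t x * d_x (vel B u) t x) a b).
Proof.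
  intros t Ht0 Ht1.
  assert (hab' : a <= b) by lra.
  assert (L : locally t (fun s => forall x, a <= x <= b -> C1_fields u s x)).
  (* The time interval is open, so the regularity holds at all times near [t]. *)
  { generalize (filter_and _ _ (open_Rbar_gt t0 t Ht0) (open_Rbar_lt t1 t Ht1)).
    apply filter_imp; intros s [H0 H1] x Hx; now apply hC1. }
  set (kp := fun x => / (rho B x * area B x)).
  set (kphi := fun x => young B x * inertia B x).
  assert (Kp : forall x, a <= x <= b -> continuous kp x)
    by (intros x Hx; now apply C1_near_continuous, (C1_near_compliance a b)).
  assert (Kw : forall x, a <= x <= b -> continuous (tension B) x)
    by (intros x Hx; now apply C1_near_continuous, (tension_C1 _ _ _ hB)).
  assert (Kphi : forall x, a <= x <= b -> continuous kphi x)
    by (intros x Hx; now apply C1_near_continuous, (C1_near_stiffness a b)).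
  assert (Lp : locally t (fun s => forall x, a <= x <= b -> C1_near_2d (p_w u) s x))
    by (revert L; apply filter_imp; intros s H x Hx; now apply p_w_C1, H).
  assert (Lw : locally t (fun s => forall x, a <= x <= b -> C1_near_2d (eps_w u) s x))
    by (revert L; apply filter_imp; intros s H x Hx; now apply eps_w_C1, H).
  assert (Lphi : locally t (fun s => forall x, a <= x <= b -> C1_near_2d (eps_phi u) s x))
    by (revert L; apply filter_imp; intros s H x Hx; now apply eps_phi_C1, H).
  set (sq := fun k (f : R -> R -> R) s => RInt (fun x : R => k x * f s x ^ 2) a b).
  set (rate := fun k (f : R -> R -> R) (x : R) => 2 * (k x * f t x * d_t f t x)).
  (* Splitting the energy into three weighted squares needs each of them to be integrable, which is
     known for times near [t]; hence the local form of extensionality. *)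
  apply is_derive_ext_loc with
    (fun s => / 2 * (sq kp (p_w u) s + sq (tension B) (eps_w u) s
                     + sq kphi (eps_phi u) s)).
  { generalize (filter_and _ _ (ex_RInt_weighted_square _ _ _ _ _ hab' Kp Lp)
      (filter_and _ _ (ex_RInt_weighted_square _ _ _ _ _ hab' Kw Lw)
         (ex_RInt_weighted_square _ _ _ _ _ hab' Kphi Lphi))).
    apply filter_imp; intros s [Ip [Iw Iphi]].
    unfold hamiltonian. f_equal. symmetry; apply is_RInt_unique.
    apply (is_RInt_ext (fun x => plus (plus (kp x * p_w u s x ^ 2)
      (tension B x * eps_w u s x ^ 2)) (kphi x * eps_phi u s x ^ 2))).
    - intros x _. unfold plus, kp, kphi; simpl. unfold Rdiv. ring.
    - apply @is_RInt_plus; [ apply @is_RInt_plus | ];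
        now apply (@RInt_correct R_CompleteNormedModule). }
  replace (bracket _ a b) with
    (/ 2 * (RInt (rate kp (p_w u)) a b + RInt (rate (tension B) (eps_w u)) a b
            + RInt (rate kphi (eps_phi u)) a b)).
  { apply is_derive_scal.
    apply @is_derive_plus; [ apply @is_derive_plus | ];
      now apply is_derive_RInt_weighted_square. }
  (* The pointwise balance identifies half the sum of the rates with the space derivative of the
     flux, so both have the same integral. *)
  assert (I : is_RInt (Derive (power_flux B u t)) a b
    (/ 2 * (RInt (rate kp (p_w u)) a b + RInt (rate (tension B) (eps_w u)) a b
            + RInt (rate kphi (eps_phi u)) a b))).
  { apply (is_RInt_ext (fun x => scal (/ 2) (plus (plus (rate kp (p_w u) x)
      (rate (tension B) (eps_w u) x)) (rate kphi (eps_phi u) x)))).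
    - rewrite Rmin_left, Rmax_right by assumption. intros x Hx.
      assert (Hx' : a <= x <= b) by lra.
      rewrite (Derive_power_flux a b); auto.
      fold (kp x) (kphi x).
      unfold scal, plus, rate; simpl. unfold mult; simpl. field.
    - apply @is_RInt_scal. apply @is_RInt_plus; [ apply @is_RInt_plus | ];
        now apply (@RInt_correct R_CompleteNormedModule),
          ex_RInt_weighted_square_rate. }
  (* The fundamental theorem of calculus leaves the flux at [a] and [b]; the algebraic rows there
     replace [effort_N] and [omega] by the derivatives in the bracket. *)
  rewrite <- (is_RInt_unique _ _ _ _ I), RInt_Derive.
  - unfold bracket, power_flux.
    destruct (hEB t a) as [_ _ _ Na oa]; auto; try lra.
    destruct (hEB t b) as [_ _ _ Nb ob]; auto; try lra.
    replace (effort_N u t a) with (- d_x (sigma_phi B u) t a) by lra.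
    replace (effort_N u t b) with (- d_x (sigma_phi B u) t b) by lra.
    replace (omega u t a) with (d_x (vel B u) t a) by lra.
    replace (omega u t b) with (d_x (vel B u) t b) by lra.
    ring.
  - rewrite Rmin_left, Rmax_right by assumption. intros x Hx.
    apply C1_near_ex_derive, (C1_near_power_flux a b); auto.
  - rewrite Rmin_left, Rmax_right by assumption. intros x Hx.
    apply C1_near_continuous_Derive, (C1_near_power_flux a b); auto.
Qed.
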